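(* Let $R$, $R'$ and $U$ be TRSs over $\Sigma$ and $T\subseteq\mathcal{T}(\Sigma,\emptyset)$ such that $U$ is terminating relative to $R\cup R'$ on $T$. Then $U\cup R'$ is terminating relative to $R$ on $T$ if and only if there exist an extended well-founded monotone partial $\Sigma$-algebra $(A,[\![\cdot]\!],\succ,\sqsupseteq)$ and a relation $\leadsto$ on $A$ such that: (1) $T$ is defined, i.e. $[\![t]\!]$ is defined for every $t\in T$; (2) $(A,[\![\cdot]\!],\leadsto)$ is a monotone partial $\Sigma$-algebra; (3) $\succ$, $\sqsupseteq$ and $\leadsto$ are partial models for $R'$, $R$ and $U$, respectively.
   Context: A TRS over $\Sigma$ is a set of rules $\ell\to r$ ($\ell\notin\mathcal{X}$, $\mathrm{Var}(r)\subseteq\mathrm{Var}(\ell)$) with usual one-step rewrite relation. For relations $\to_1,\to_2$ on a set $A$, $\to_1$ is terminating relative to $\to_2$ on $B\subseteq A$ if $\to_2^*\cdot\to_1\cdot\to_2^*$ admits no infinite sequence starting in $B$; for TRSs, $P$ is terminating relative to $Q$ on $T$ if $\to_P$ is terminating relative to $\to_Q$ on $T$. A partial $\Sigma$-algebra $(A,[\![\cdot]\!])$: non-empty $A$, partial functions $[\![f]\!]:A^n\rightharpoonup A$; term interpretation under $\alpha:\mathcal{X}\to A$: $[\![x]\!]_\alpha=\alpha(x)$, $[\![f(t_1,\dots,t_n)]\!]_\alpha=[\![f]\!]([\![t_1]\!]_\alpha,\dots,[\![t_n]\!]_\alpha)$, defined only if all subexpressions are; $[\![t]\!]$ for ground $t$.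 A partial function is closed w.r.t. relation $\rho$ if $f(\dots,a,\dots)$ defined and $a\,\rho\,b$ imply $f(\dots,b,\dots)$ defined; monotone w.r.t. $\rho$ if $f(\dots,a,\dots)$, $f(\dots,b,\dots)$ defined and $a\,\rho\,b$ imply $f(\dots,a,\dots)\,\rho\,f(\dots,b,\dots)$ (all positions). $(A,[\![\cdot]\!],\rho)$ is a monotone partial $\Sigma$-algebra if every $[\![f]\!]$ is closed and monotone w.r.t. $\rho$. An extended well-founded monotone partial $\Sigma$-algebra $(A,[\![\cdot]\!],\succ,\sqsupseteq)$: $(A,[\![\cdot]\!],\succ)$ and $(A,[\![\cdot]\!],\sqsupseteq)$ are monotone partial $\Sigma$-algebras and $\succ$ is terminating relative to $\sqsupseteq$ on $A$. A relation $\rho$ is a partial model for a TRS $R$ if for all $\ell\to r\in R$ and $\alpha:\mathrm{Var}(\ell)\to A$ with $[\![\ell]\!]_\alpha$ defined, $[\![\ell]\!]_\alpha\,\rho\,[\![r]\!]_\alpha$. *)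

(* Defs.v *)
From Stdlib Require Export Relation_Operators.
From mathcomp Require Export all_boot.
From mathcomp Require Export boolp classical_sets.

Set Implicit Arguments.
Unset Strict Implicit.
Unset Printing Implicit Defensive.

Local Open Scope classical_set_scope.

Record signature := Signature { symbol : Type; arity : symbol -> nat }.

(* Two argument vectors of the shapes (.., a, ..) and (.., b, ..), where a and
   b stand at position i. *)
Definition agree_off (T : Type) (n : nat) (i : 'I_n)
    (xs ys : {ffun 'I_n -> T}) : Prop :=
  forall j : 'I_n, j != i -> xs j = ys j.

Section Terms.
Variables (Sigma : signature) (X : Type).

Inductive term : Type :=
| TVar of X
| TApp (f : symbol Sigma) of {ffun 'I_(arity f) -> term}.

(* The automatically generated principle has no hypothesis for the arguments. *)
Lemma term_nested_ind (P : term -> Prop) :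
    (forall x, P (TVar x)) ->
    (forall f (ts : {ffun 'I_(arity f) -> term}),
       (forall i, P (ts i)) -> P (TApp ts)) ->
  forall t, P t.
Proof.
move=> Pvar Papp; fix IH 1; case=> [x|f ts]; first exact: Pvar.
by apply: Papp => i; apply: IH.
Qed.

Fixpoint vars (t : term) : set X :=
  match t with
  | TVar x => [set x]
  | TApp f ts => [set x | exists i, vars (ts i) x]
  end.

Definition ground : set term := [set t | vars t = set0].

Fixpoint subst (s : X -> term) (t : term) : term :=
  match t with
  | TVar x => s x
  | TApp f ts => TApp [ffun i => subst s (ts i)]
  end.

Definition rule : Type := (term * term)%type.

Definition is_trs (R : set rule) : Prop :=
  forall l r, R (l, r) -> (forall x, l <> TVar x) /\ vars r `<=` vars l.

Inductive rewrites (R : set rule) : term -> term -> Prop :=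
| rewrites_root l r s : R (l, r) -> rewrites R (subst s l) (subst s r)
| rewrites_arg f (i : 'I_(arity f)) (ts us : {ffun 'I_(arity f) -> term}) :
    agree_off i ts us -> rewrites R (ts i) (us i) ->
    rewrites R (TApp ts) (TApp us).

End Terms.

Section RelativeTermination.
Variable A : Type.

Definition relative_step (r1 r2 : A -> A -> Prop) (a b : A) : Prop :=
  exists a' b', [/\ clos_refl_trans A r2 a a', r1 a' b'
                  & clos_refl_trans A r2 b' b].

Definition terminating_relative (r1 r2 : A -> A -> Prop) (B : set A) : Prop :=
  ~ exists u : nat -> A, B (u 0) /\ forall n, relative_step r1 r2 (u n) (u n.+1).

End RelativeTermination.

(* The value None means that the operation is undefined. *)
Record partial_algebra (Sigma : signature) := PartialAlgebra {
  carrier :> Type;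
  carrier_inhabited : inhabited carrier;
  op : forall f : symbol Sigma,
    {ffun 'I_(arity f) -> carrier} -> option carrier
}.

Section PartialAlgebras.
Variables (Sigma : signature) (A : partial_algebra Sigma).

(* interp alpha t a: the interpretation of t under alpha is defined and equal
   to a. *)
Inductive interp (X : Type) (alpha : X -> A) : term Sigma X -> A -> Prop :=
| interp_var x : interp alpha (TVar Sigma x) (alpha x)
| interp_app (f : symbol Sigma) (ts : {ffun 'I_(arity f) -> term Sigma X})
    (xs : {ffun 'I_(arity f) -> A}) (a : A) :
    (forall i, interp alpha (ts i) (xs i)) -> op xs = Some a ->
    interp alpha (TApp ts) a.

Lemma interp_ground (X : Type) (alpha beta : X -> A) t a :
  ground t -> interp alpha t a -> interp beta t a.
Proof.
rewrite /ground /= => gt ta; elim: ta gt => {t a} [x|f ts xs a _ IH opa] gt.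
  by have : [set x] x by []; rewrite [X in X x]gt.
apply: interp_app opa => i; apply: IH; rewrite -subset0 => x tx.
by rewrite -gt /=; exists i.
Qed.

(* By interp_ground the choice of the assignment is immaterial. *)
Definition ground_defined (X : Type) (t : term Sigma X) : Prop :=
  forall alpha : X -> A, exists a, interp alpha t a.

Definition closed_op (n : nat) (F : {ffun 'I_n -> A} -> option A)
    (rho : A -> A -> Prop) : Prop :=
  forall (i : 'I_n) (xs ys : {ffun 'I_n -> A}),
    agree_off i xs ys -> rho (xs i) (ys i) ->
    F xs <> None -> F ys <> None.

Definition monotone_op (n : nat) (F : {ffun 'I_n -> A} -> option A)
    (rho : A -> A -> Prop) : Prop :=
  forall (i : 'I_n) (xs ys : {ffun 'I_n -> A}) (a b : A),
    agree_off i xs ys -> rho (xs i) (ys i) ->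
    F xs = Some a -> F ys = Some b -> rho a b.

Definition monotone_partial_algebra (rho : A -> A -> Prop) : Prop :=
  forall f : symbol Sigma,
    closed_op (@op Sigma A f) rho /\ monotone_op (@op Sigma A f) rho.

Definition ext_wf_monotone_partial_algebra (gt ge : A -> A -> Prop) : Prop :=
  [/\ monotone_partial_algebra gt, monotone_partial_algebra ge
    & terminating_relative gt ge setT].

(* As the carrier is inhabited and vars r is included in vars l, assignments
   of all variables and assignments of vars l give the same notion. *)
Definition partial_model (X : Type) (rho : A -> A -> Prop)
    (R : set (rule Sigma X)) : Prop :=
  forall l r, R (l, r) -> forall (alpha : X -> A) (a : A),
    interp alpha l a -> exists2 b, interp alpha r b & rho a b.

End PartialAlgebras.

(* Main.v *)
Require Import Defs.

Set Implicit Arguments.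
Unset Strict Implicit.
Unset Printing Implicit Defensive.

Local Open Scope classical_set_scope.

(** From the algebra to termination: since [U] terminates relative to
    [R `|` R'], an infinite sequence of [U `|` R'] steps relative to [R] uses
    only finitely many [U] steps.  Interpretations stay defined along rewriting
    (the role of [leadsto] is to carry definedness across the [U] steps), so
    the remaining tail is mapped to an infinite sequence of [gt] steps
    relative to [ge].

    Conversely, the carrier is the set of all terms, [f(ts)] is defined exactly
    when it admits no infinite sequence of [U `|` R'] steps relative to [R], and
    the three relations are the rewrite relations restricted to sources without
    such a sequence. *)

(** * Termination of one relation relative to another *)

Section RelativeTerminationTheory.
Variable A : Type.
Implicit Types r p q : A -> A -> Prop.

Definition rel_terminates r q (a : A) : Prop := terminating_relative r q [set a].

Lemma clos_refl_trans_sim (B : Type) q (q' : B -> B -> Prop)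
    (D : A -> B -> Prop) :
    (forall a b x, q a b -> D a x -> exists2 y, D b y & q' x y) ->
  forall a b x, clos_refl_trans A q a b -> D a x ->
  exists2 y, D b y & clos_refl_trans B q' x y.
Proof.
move=> sim a b x ab; elim: ab x => {a b} [a b ab x Dx|a x Dx|a b c _ IH1 _ IH2 x].
- by have [y Dy xy] := sim _ _ _ ab Dx; exists y => //; apply: rt_step.
- by exists x => //; apply: rt_refl.
- move=> /IH1[y /IH2[z Dz yz] xy]; exists z => //; exact: rt_trans xy yz.
Qed.

(** [D] is carried along the three segments of a relative step in turn. It will be the graph of a
    function or the interpretation of terms. *)
Lemma relative_step_sim (B : Type) r q (r' q' : B -> B -> Prop)
    (D : A -> B -> Prop) :
    (forall a b x, r a b -> D a x -> exists2 y, D b y & r' x y) ->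
    (forall a b x, q a b -> D a x -> exists2 y, D b y & q' x y) ->
  forall a b x, relative_step r q a b -> D a x ->
  exists2 y, D b y & relative_step r' q' x y.
Proof.
move=> simr simq a b x [a' [b' [aa' ab' b'b]]] Dx.
have [x' Dx' xx'] := clos_refl_trans_sim simq aa' Dx.
have [y' Dy' xy'] := simr _ _ _ ab' Dx'.
have [y Dy y'y] := clos_refl_trans_sim simq b'b Dy'.
by exists y => //; exists x', y'.
Qed.

Lemma relative_step_map (B : Type) r q (r' q' : B -> B -> Prop) (g : A -> B) :
    (forall a b, r a b -> r' (g a) (g b)) ->
    (forall a b, q a b -> q' (g a) (g b)) ->
  forall a b, relative_step r q a b -> relative_step r' q' (g a) (g b).
Proof.
move=> mr mq a b ab.
have [||_ <- //] := @relative_step_sim _ r q r' q' (fun a x => g a = x)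
  _ _ _ _ _ ab erefl.
- by move=> c d _ /mr ? <-; exists (g d).
- by move=> c d _ /mq ? <-; exists (g d).
Qed.

Lemma clos_refl_trans_sub r q : (forall a b, r a b -> q a b) ->
  forall a b, clos_refl_trans A r a b -> clos_refl_trans A q a b.
Proof.
move=> rq a b; elim=> {a b} [a b /rq|a|a b c _ ab _ bc].
- exact: rt_step.
- exact: rt_refl.
- exact: rt_trans ab bc.
Qed.

Lemma relative_step_refl_trans r q a b :
  relative_step r q a b ->
  clos_refl_trans A (fun x y => q x y \/ r x y) a b.
Proof.
move=> [a' [b' [aa' ab b'b]]]; apply: (@rt_trans _ _ _ a').
  by apply: clos_refl_trans_sub aa' => ? ?; left.
apply: (@rt_trans _ _ _ b'); first by apply: rt_step; right.
by apply: clos_refl_trans_sub b'b => ? ?; left.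
Qed.

Lemma relative_step_union r p q a b :
    relative_step (fun x y => r x y \/ p x y) q a b ->
  relative_step r q a b \/ relative_step p q a b.
Proof.
by move=> [a' [b' [aa' [rab|pab] b'b]]]; [left|right]; exists a', b'.
Qed.

Lemma relative_step_transl r q a b c :
  clos_refl_trans A q a b -> relative_step r q b c -> relative_step r q a c.
Proof.
move=> ab [a' [b' [ba' ab' b'c]]]; exists a', b'; split=> //.
exact: rt_trans ab ba'.
Qed.

Lemma rel_terminates_ge r q a b : rel_terminates r q a -> q a b ->
  rel_terminates r q b.
Proof.
move=> ta ab [u [/= ub us]]; apply: ta.
(* The [q] step is absorbed into the first relative step, so [a] takes the place of the first
   entry. *)
exists (fun n => if n is 0 then a else u n); split=> // -[|n] //.
by apply: relative_step_transl (us 0); rewrite ub; apply: rt_step.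
Qed.

Lemma rel_terminates_gt r q a b : rel_terminates r q a -> r a b ->
  rel_terminates r q b.
Proof.
move=> ta ab [u [/= ub us]]; apply: ta.
(* Here the [r] step is itself a relative step, so [a] is prepended. *)
exists (fun n => if n is m.+1 then u m else a); split=> // -[|n] //.
by exists a, b; rewrite ub; split=> //; apply: rt_refl.
Qed.

Lemma terminating_relativeP r q (B : set A) :
  terminating_relative r q B <-> forall a, B a -> rel_terminates r q a.
Proof.
split=> [tB a Ba [u [/= ua us]]|tB [u [Bu us]]].
  by apply: tB; exists u; rewrite ua.
by apply: (tB _ Bu); exists u.
Qed.

(** Otherwise relative [r] steps occur arbitrarily late. Absorbing the [p] steps between them into
    the second relation gives an infinite sequence from [u 0]. *)
Lemma terminating_relative_tail r p q (u : nat -> A) :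
    rel_terminates r (fun x y => q x y \/ p x y) (u 0) ->
    (forall n, relative_step (fun x y => r x y \/ p x y) q (u n) (u n.+1)) ->
  exists N, forall n, N <= n -> relative_step p q (u n) (u n.+1).
Proof.
move=> tu us; apply: contrapT => noN; apply: tu.
set qp := fun x y => q x y \/ p x y.
have first_r N : exists m, relative_step r qp (u N) (u m).
  have [k rk] : exists k, relative_step r q (u (k + N)) (u (k + N).+1).
    apply: contrapT => nor; apply: noN; exists N => n leNn.
    have [rn|//] := relative_step_union (us n).
    by case: nor; exists (n - N); rewrite subnK.
  (* Induction on the distance [k] to a relative [r] step; the relative [p] steps met before it
     become part of [qp]. *)
  elim: k N rk => [|k IH] N rN.
    exists N.+1; apply: (@relative_step_map A r q r qp id) rN => // a b; by left.
  have [rN'|pN] := relative_step_union (us N).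
    exists N.+1; apply: (@relative_step_map A r q r qp id) rN' => // a b; by left.
  have [m mP] : exists m, relative_step r qp (u N.+1) (u m).
    by apply: IH; rewrite addnS -addSn.
  by exists m; apply: relative_step_transl (relative_step_refl_trans pN) mP.
have [m mP] := choice first_r.
by exists (fun k => u (iter k m 0)); split=> // k; apply: mP.
Qed.

End RelativeTerminationTheory.

(** * Rewriting under unions of rule sets and in contexts *)

Section RewritingTheory.
Variables (Sigma : signature) (X : Type).
Implicit Types (Q : set (rule Sigma X)) (t u : term Sigma X).

Lemma rewrites_sub Q1 Q2 : Q1 `<=` Q2 ->
  forall t u, rewrites Q1 t u -> rewrites Q2 t u.
Proof.
move=> sub t u; elim=> {t u} [l r s /sub|f i ts us ag _ IH].
  exact: rewrites_root.
exact: rewrites_arg ag IH.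
Qed.

Lemma rewrites_setU Q1 Q2 :
  rewrites (Q1 `|` Q2) = fun t u => rewrites Q1 t u \/ rewrites Q2 t u.
Proof.
apply/funext => t; apply/funext => u; apply/propext; split.
  elim=> {t u} [l r s [?|?]|f i ts us ag _ [?|?]].
  - by left; apply: rewrites_root.
  - by right; apply: rewrites_root.
  - by left; apply: (rewrites_arg ag).
  - by right; apply: (rewrites_arg ag).
by case; apply: rewrites_sub => ? ?; [left|right].
Qed.

Lemma subst_ground (s : X -> term Sigma X) t : ground t -> subst s t = t.
Proof.
elim/term_nested_ind: t => [x gx|f ts IH gt] /=.
  by have : [set x] x by []; rewrite [X in X x]gx.
congr TApp; apply/ffunP => i; rewrite ffunE; apply: IH.
by apply/seteqP; split=> // x tx; rewrite -gt /=; exists i.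
Qed.

Definition replace_arg (T : Type) n (i : 'I_n) (xs : {ffun 'I_n -> T}) (a : T) :
  {ffun 'I_n -> T} := [ffun j => if j == i then a else xs j].

Lemma replace_arg_eq (T : Type) n (i : 'I_n) (xs : {ffun 'I_n -> T}) a :
  replace_arg i xs a i = a.
Proof. by rewrite ffunE eqxx. Qed.

Lemma replace_arg_id (T : Type) n (i : 'I_n) (xs : {ffun 'I_n -> T}) :
  replace_arg i xs (xs i) = xs.
Proof. by apply/ffunP => j; rewrite ffunE; case: eqP => // ->. Qed.

Lemma agree_off_replace_arg (T : Type) n (i : 'I_n) (xs : {ffun 'I_n -> T}) a :
  agree_off i xs (replace_arg i xs a).
Proof. by move=> j /negPf ji; rewrite ffunE ji. Qed.

Lemma rewrites_replace_arg Q f (i : 'I_(arity f))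
    (ts : {ffun 'I_(arity f) -> term Sigma X}) t u :
  rewrites Q t u ->
  rewrites Q (TApp (replace_arg i ts t)) (TApp (replace_arg i ts u)).
Proof.
move=> tu; apply: (@rewrites_arg _ _ _ _ i); last by rewrite !replace_arg_eq.
by move=> j /negPf ji; rewrite !ffunE ji.
Qed.

(** Rewriting is closed under contexts, so an infinite sequence from [ts i] lifts to one from the
    whole term. *)
Lemma rel_terminates_arg Q1 Q2 f (ts : {ffun 'I_(arity f) -> term Sigma X}) i :
  rel_terminates (rewrites Q1) (rewrites Q2) (TApp ts) ->
  rel_terminates (rewrites Q1) (rewrites Q2) (ts i).
Proof.
move=> tts [v [/= v0 vs]]; apply: tts.
exists (fun n => TApp (replace_arg i ts (v n))); split=> [|n] /=.
  by rewrite v0 replace_arg_id.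
by apply: (@relative_step_map _ _ _ _ _ _ (fun t => TApp (replace_arg i ts t)))
  (vs n) => t u; apply: rewrites_replace_arg.
Qed.

End RewritingTheory.

(** * Interpretation of rewrite steps in partial algebras *)

Section InterpretationTheory.
Variables (Sigma : signature) (A : partial_algebra Sigma) (X : Type).
Implicit Types (alpha beta : X -> A) (t u : term Sigma X).

Lemma interp_inv alpha t a : interp alpha t a ->
  match t with
  | TVar x => a = alpha x
  | TApp f ts => exists xs : {ffun 'I_(arity f) -> A},
      (forall i, interp alpha (ts i) (xs i)) /\ op xs = Some a
  end.
Proof. by case=> // f ts xs {}a tsxs xsa; exists xs. Qed.

Lemma interp_fun alpha t a b : interp alpha t a -> interp alpha t b -> a = b.
Proof.
move=> ta; elim: ta b => {t a} [x|f ts xs a _ IH xsa] b /interp_inv //.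
move=> [ys [tsys]]; suff -> : ys = xs by rewrite xsa => -[].
by apply/ffunP => i; rewrite (IH _ _ (tsys i)).
Qed.

(** An interpretation is defined only if those of all subterms are, so each variable of [t] has a
    value for [beta] to take. *)
Lemma interp_subst alpha s t a : interp alpha (subst s t) a ->
  exists2 beta, interp beta t a &
    forall x, vars t x -> interp alpha (s x) (beta x).
Proof.
(* [beta] takes the value of [s x] where it is defined and an arbitrary element elsewhere. *)
have /choice[beta betaP] : forall x, exists c, forall b,
    interp alpha (s x) b -> interp alpha (s x) c.
  move=> x.
  have [[b sb]|nos] := pselect (exists b, interp alpha (s x) b).
    by exists b.
  by have [b0] := carrier_inhabited A; exists b0 => b sb; case: nos; exists b.
move=> sta; exists beta.
  elim/term_nested_ind: t a sta => [x|f ts IH] a /= sta.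
    by rewrite (interp_fun sta (betaP _ _ sta)); apply: interp_var.
  have [xs [tsxs xsa]] := interp_inv sta.
  by apply: interp_app xsa => i; apply: IH; have := tsxs i; rewrite ffunE.
elim/term_nested_ind: t a sta => [x|f ts IH] a /= sta y.
  by move=> ->; apply: betaP sta.
have [xs [tsxs _]] := interp_inv sta.
by move=> [i]; apply: IH (xs i) _ _; have := tsxs i; rewrite ffunE.
Qed.

Lemma subst_interp alpha beta s t a : interp beta t a ->
    (forall x, vars t x -> interp alpha (s x) (beta x)) ->
  interp alpha (subst s t) a.
Proof.
elim=> {t a} [x|f ts xs a _ IH xsa] sP /=; first exact: sP.
by apply: interp_app xsa => i; rewrite ffunE; apply: IH => x tx; apply: sP; exists i.
Qed.

(** At the root, the substitution lemmas reduce the step to the partial model. Inside an argument,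
    closedness makes the new value defined and monotonicity relates it to the old one. *)
Lemma rewrites_interp (rho : A -> A -> Prop) (Q : set (rule Sigma X)) :
    is_trs Q -> monotone_partial_algebra rho -> partial_model rho Q ->
  forall alpha t u a, rewrites Q t u -> interp alpha t a ->
  exists2 b, interp alpha u b & rho a b.
Proof.
move=> trsQ mono model alpha t u a tu; elim: tu a => {t u} [l r s lr|f i ts us ag _ IH] a.
  move=> /interp_subst[beta la sP]; have [b rb ab] := model _ _ lr _ _ la.
  exists b => //; apply: subst_interp rb _ => x rx.
  by apply: sP; have [_] := trsQ _ _ lr; apply.
move=> /interp_inv[xs [tsxs xsa]]; have [b ib rb] := IH _ (tsxs i).
have [closed_f mono_f] := mono f; set ys := replace_arg i xs b.
have agxy : agree_off i xs ys by apply: agree_off_replace_arg.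
have rxy : rho (xs i) (ys i) by rewrite replace_arg_eq.
case ysc: (op ys) => [c|]; last first.
  by case: (closed_f _ _ _ agxy rxy _ ysc); rewrite xsa.
exists c; last exact: mono_f agxy rxy xsa ysc.
apply: interp_app ysc => j; rewrite ffunE; case: eqP => [->//|/eqP ji].
by rewrite -(ag _ ji).
Qed.

End InterpretationTheory.

(** * The partial algebra of terms, defined on terminating applications *)

Section TermAlgebra.
Variables (Sigma : signature) (X : Type).
Variables (Q1 Q2 : set (rule Sigma X)) (t0 : term Sigma X).

Let S := rel_terminates (rewrites Q1) (rewrites Q2).

Definition terminating_term_algebra : partial_algebra Sigma :=
  @PartialAlgebra Sigma (term Sigma X) (inhabits t0)
    (fun f ts => if `[< S (TApp ts) >] then Some (TApp ts) else None).

Let A := terminating_term_algebra.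

(** The carrier also contains non-terminating terms; [S t] keeps them from breaking relative
    termination on [setT]. *)
Definition restricted_rewrites (Q : set (rule Sigma X)) (t u : A) : Prop :=
  S t /\ rewrites Q t u.

Lemma terminating_term_opP f (ts : {ffun 'I_(arity f) -> A}) (a : A) :
  op ts = Some a <-> a = TApp ts /\ S (TApp ts).
Proof.
rewrite /=; case: asboolP => tsS; split=> //.
- by move=> [<-].
- by move=> [->].
- by case.
Qed.

(** Subterms of terminating terms terminate, so every operation involved is defined. *)
Lemma interp_terminating_term (alpha : X -> A) t :
  S (subst alpha t) -> interp alpha t (subst alpha t).
Proof.
elim/term_nested_ind: t => [x|f ts IH] /= St; first exact: interp_var.
apply: (@interp_app _ A _ _ _ _ [ffun i => subst alpha (ts i)]).
  move=> i; rewrite ffunE; apply: IH.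
  by have := rel_terminates_arg (i := i) St; rewrite ffunE.
exact/terminating_term_opP.
Qed.

Lemma interp_terminating_termE (alpha : X -> A) t a :
  interp alpha t a -> a = subst alpha t.
Proof.
elim=> {t a} [x|f ts xs a _ IH] //= /terminating_term_opP[-> _].
by congr TApp; apply/ffunP => i; rewrite ffunE IH.
Qed.

Lemma rel_terminates_rewrites (Q : set (rule Sigma X)) :
    Q `<=` Q1 \/ Q `<=` Q2 ->
  forall t u, rewrites Q t u -> S t -> S u.
Proof.
move=> [sub|sub] t u tu St.
  exact: rel_terminates_gt St (rewrites_sub sub tu).
exact: rel_terminates_ge St (rewrites_sub sub tu).
Qed.

(** Rewriting preserves [S], which gives closedness. Closure under contexts gives monotonicity, with
    [S] read off from the defined value. *)
Lemma monotone_restricted_rewrites (Q : set (rule Sigma X)) :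
  Q `<=` Q1 \/ Q `<=` Q2 ->
  monotone_partial_algebra (restricted_rewrites Q).
Proof.
move=> sub f; split=> [i xs ys ag [_ xy]|i xs ys a b ag [_ xy]].
  case opx: (op xs) => [a|] // _.
  have [_ Sx] := (terminating_term_opP xs a).1 opx.
  suff /terminating_term_opP -> : TApp ys = TApp ys /\ S (TApp ys) by [].
  by split=> //; apply: (rel_terminates_rewrites sub (rewrites_arg ag xy) Sx).
move=> /terminating_term_opP[-> Sx] /terminating_term_opP[-> _].
by split=> //; apply: rewrites_arg ag xy.
Qed.

Lemma partial_model_restricted_rewrites (Q : set (rule Sigma X)) :
    is_trs Q -> Q `<=` Q1 \/ Q `<=` Q2 ->
  partial_model (restricted_rewrites Q) Q.
Proof.
move=> trsQ sub l r lr alpha a la.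
have [lnv _] := trsQ _ _ lr.
have rew : rewrites Q (subst alpha l) (subst alpha r) by apply: rewrites_root.
have aE := interp_terminating_termE la.
(* As [l] is not a variable, its value is the result of an operation and hence lies in [S]. *)
have Sl : S (subst alpha l).
  case: l lnv la {lr rew} aE => [x /(_ x)//|f ts _ /interp_inv[xs [_]]].
  by move=> /terminating_term_opP[-> ?] <-.
exists (subst alpha r); last by rewrite aE.
by apply: interp_terminating_term; apply: (rel_terminates_rewrites sub rew Sl).
Qed.

Lemma terminating_restricted_rewrites (Q : set (rule Sigma X)) : Q `<=` Q1 ->
  terminating_relative (restricted_rewrites Q) (restricted_rewrites Q2) setT.
Proof.
move=> sub [u [_ us]].
(* The first restricted step out of [u 0], of either kind, has its source in [S]. *)
have S0 : S (u 0).
  have [a' [b' [ua [Sa _] _]]] := us 0.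
  elim: ua Sa {us} => {a' b'} // [a b [] //|a b c _ IH1 _ IH2 Sc].
  exact/IH1/IH2.
apply: S0; exists u; split=> // n.
apply: (@relative_step_map _ _ _ _ _ _ id) (us n) => a b [] // _.
exact: rewrites_sub.
Qed.

End TermAlgebra.

Theorem theorem5p2 (Sigma : signature) (X : Type)
    (R R' U : set (rule Sigma X))
    (trsR : is_trs R) (trsR' : is_trs R') (trsU : is_trs U)
    (T : set (term Sigma X)) (groundT : T `<=` @ground Sigma X)
    (termU : terminating_relative (rewrites U) (rewrites (R `|` R')) T) :
  terminating_relative (rewrites (U `|` R')) (rewrites R) T <->
  exists (A : partial_algebra Sigma) (gt ge leadsto : A -> A -> Prop),
    [/\ ext_wf_monotone_partial_algebra gt ge,
        forall t, T t -> ground_defined A t,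
        monotone_partial_algebra leadsto
      & [/\ partial_model gt R', partial_model ge R
          & partial_model leadsto U]].
Proof.
split=> [/terminating_relativeP tT|].
  have [[t0]|noterm] := pselect (inhabited (term Sigma X)); last first.
    (* Without terms there are no rules either. *)
    pose E := @PartialAlgebra Sigma unit (inhabits tt) (fun _ _ => None).
    have modelE Q : @partial_model _ E X (fun _ _ => False) Q.
      by move=> l; case: noterm; exists.
    have monoE : @monotone_partial_algebra _ E (fun _ _ => False).
      by move=> f; split=> [i xs ys _ []|i xs ys a b _ []].
    exists E, (fun _ _ => False), (fun _ _ => False), (fun _ _ => False).
    split=> //.
      by split=> // -[u [_ /(_ 0)[? [? []]]]].
    by move=> t; case: noterm; exists.
  have subU : U `<=` U `|` R' \/ U `<=` R by left=> ?; left.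
  have subR' : R' `<=` U `|` R' \/ R' `<=` R by left=> ?; right.
  have subR : R `<=` U `|` R' \/ R `<=` R by right.
  exists (terminating_term_algebra (U `|` R') R t0).
  exists (@restricted_rewrites _ _ (U `|` R') R t0 R').
  exists (@restricted_rewrites _ _ (U `|` R') R t0 R).
  exists (@restricted_rewrites _ _ (U `|` R') R t0 U).
  split.
  - split; try exact: monotone_restricted_rewrites.
    by apply: terminating_restricted_rewrites => ?; right.
  - move=> t Tt alpha; exists (subst alpha t); apply: interp_terminating_term.
    by rewrite subst_ground; [apply: tT|apply: groundT].
  - exact: monotone_restricted_rewrites.
  - by split; apply: partial_model_restricted_rewrites.
move=> [A [gt [ge [leadsto [[mgt mge wf] defT mlt [modR' modR modU]]]]]].
move=> [u [Tu0 us]]; have [a0] := carrier_inhabited A.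
(* Terms of [T] are defined under every assignment, so a constant one is enough. *)
pose alpha (_ : X) := a0; pose D t (a : A) := interp alpha t a.
have simR' t v a := @rewrites_interp _ _ _ _ _ trsR' mgt modR' alpha t v a.
have simR t v a := @rewrites_interp _ _ _ _ _ trsR mge modR alpha t v a.
have simU t v a := @rewrites_interp _ _ _ _ _ trsU mlt modU alpha t v a.
rewrite rewrites_setU in us.
(* By [termU] the [U] steps run out, and only [R'] steps relative to [R] remain. *)
have [N uN] : exists N, forall n, N <= n ->
    relative_step (rewrites R') (rewrites R) (u n) (u n.+1).
  apply: terminating_relative_tail us.
  by rewrite -rewrites_setU; move/terminating_relativeP: termU; apply.
have defu n : exists a, D (u n) a.
  elim: n => [|n [a Da]]; first exact: defT.
  (* The union of [leadsto] and [gt] simulates [U] and [R'] together; only the definedness of the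
     target is kept. *)
  have [||b Db _] := relative_step_sim (D := D)
    (r' := fun a b => leadsto a b \/ gt a b) (q' := ge) _ _ (us n) Da.
  - move=> t v c [tv|tv] Dc.
      by have [d Dd cd] := simU _ _ _ tv Dc; exists d => //; left.
    by have [d Dd cd] := simR' _ _ _ tv Dc; exists d => //; right.
  - exact: simR.
  - by exists b.
have [v vP] := choice defu.
(* The values from index [N] on contradict [wf]; uniqueness of interpretations identifies each
   simulated target with the chosen value. *)
apply: wf; exists (fun n => v (N + n)); split=> // n.
have [b Db vb] := relative_step_sim (D := D) simR' simR
  (uN _ (leq_addr n N)) (vP (N + n)).
by rewrite addnS (interp_fun (vP (N + n).+1) Db).
Qed.
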